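(* The tetrahedral POVM $(\pi_y)_{y=1}^4$ on $\mathbb{C}^2$ is a $2$-design POVM, its informational power is $$W(\pi_y) = \ln\frac43,$$ and the supremum defining $W(\pi_y)$ is attained by the anti-tetrahedral ensemble $(\psi_x)_{x=1}^4$, which satisfies $\psi_x\pi_x = 0$ for every $x$.
   Context: Let $\sigma=(\sigma_1,\sigma_2,\sigma_3)$ be the Pauli matrices, and let $n_1,\dots,n_N$ be the vertices of a regular polyhedron inscribed in the unit sphere of $\mathbb{R}^3$. The associated POVM on $\mathbb{C}^2$ is $\pi_y = \frac1N(\mathbb{1}_2 + n_y\cdot\sigma)$, $y=1,\dots,N$, and the associated anti-ensemble is $\psi_x = \frac{1}{2N}(\mathbb{1}_2 - n_x\cdot\sigma)$, $x=1,\dots,N$. The tetrahedral POVM and anti-tetrahedral ensemble correspond to the regular tetrahedron ($N=4$). A finite POVM $(\pi_y)$ on $\mathbb{C}^d$ (positive semidefinite operators with $\sum_y\pi_y=\mathbb{1}_d$) is a $t$-design POVM if for every integer $1\le k\le t$, $\sum_y \frac{\pi_y^{\otimes k}}{\operatorname{Tr}[\pi_y]^{k-1}} = d\binom{d-1+k}{k}^{-1} P_{\mathrm{sym}}$, where $P_{\mathrm{sym}}$ is the orthogonal projector onto the symmetric subspace of $(\mathbb{C}^d)^{\otimes k}$. An ensemble is a measurable function $x\mapsto\rho_x$ from the reals to positive semidefinite operators of trace at most $1$ with $\int\operatorname{Tr}[\rho_x]\,dx=1$; finite ensembles $(\rho_x)$ with $\sum_x\operatorname{Tr}[\rho_x]=1$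 are included (sums in place of integrals). With $p_{x,y}=\operatorname{Tr}[\rho_x\pi_y]$ and marginals $p_x,p_y$, the mutual information is $I(\rho_x,\pi_y) := \int\sum_y p_{x,y}\ln\frac{p_{x,y}}{p_xp_y}\,dx$ (with $0\ln0=0$). The informational power is $W(\pi_y) := \sup_{\rho_x} I(\rho_x,\pi_y)$ over all ensembles. *)

(* Defs.v *)
(* MathComp-Analysis. The scalars are R[i] (the complex numbers over a realType
   R, from mathcomp-real-closed); R itself carries its Borel sigma-algebra and
   the Lebesgue measure. *)
From HB Require Import structures.
From mathcomp Require Import all_boot all_order all_algebra all_fingroup.
From mathcomp Require Import all_classical all_reals all_analysis.
From mathcomp.real_closed Require Import complex.
From mathcomp.real_closed Require mxtens.

Set Implicit Arguments.
Unset Strict Implicit.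
Unset Printing Implicit Defensive.
Import Order.TTheory GRing.Theory Num.Theory.
Local Open Scope classical_set_scope.
Local Open Scope ring_scope.
Local Open Scope sesquilinear_scope.

(* MathComp-Analysis equips 'rV[R]_3 with the sup norm, hence this explicit
   Euclidean norm. *)
Definition eucl_norm (R : realType) (k : nat) (u : 'rV[R]_k) : R :=
  Num.sqrt (\sum_(l < k) u 0 l ^+ 2).

(* A tetrahedron is regular when its six edges have the same length; a > 0
   excludes the degenerate case where all the points coincide. *)
Definition inscribed_regular_tetrahedron (R : realType)
    (n : 'I_4 -> 'rV[R]_3) : Prop :=
  (forall y, eucl_norm (n y) = 1) /\
  (exists2 a : R, 0 < a & forall y z, y != z -> eucl_norm (n y - n z) = a).

Definition mx2 (K : Type) (a b c d : K) : 'M[K]_2 :=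
  \matrix_(i < 2, j < 2)
    if i == 0 then (if j == 0 then a else b) else (if j == 0 then c else d).

Definition pauli (R : realType) (l : 'I_3) : 'M[R[i]]_2 :=
  match val l with
  | 0%N => mx2 0 1 1 0
  | 1%N => mx2 0 (- 'i%C) 'i%C 0
  | _ => mx2 1 0 0 (- 1)
  end.

Definition dot_pauli (R : realType) (u : 'rV[R]_3) : 'M[R[i]]_2 :=
  \sum_(l < 3) (u 0 l)%:C%C *: pauli R l.

Definition vertex_povm (R : realType) (N : nat) (n : 'I_N -> 'rV[R]_3)
    (y : 'I_N) : 'M[R[i]]_2 :=
  N%:R^-1 *: (1%:M + dot_pauli (n y)).

Definition anti_ensemble (R : realType) (N : nat) (n : 'I_N -> 'rV[R]_3)
    (x : 'I_N) : 'M[R[i]]_2 :=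
  (2 * N)%:R^-1 *: (1%:M - dot_pauli (n x)).

Definition psd (R : realType) (d : nat) (A : 'M[R[i]]_d) : Prop :=
  A \is hermsymmx /\ forall v : 'cV[R[i]]_d, 0 <= (v^t* *m A *m v) 0 0.

Definition is_povm (R : realType) (d N : nat) (pi : 'I_N -> 'M[R[i]]_d)
    : Prop :=
  (forall y, psd (pi y)) /\ \sum_y pi y = 1%:M.

(* (C^d)^{(x)k} is 'rV_(d ^ k), indexed as in mxtens.ntensmx: the basis vector
   e_(c_0) (x) ... (x) e_(c_(k-1)) has the index whose base-d digits are
   c_0, ..., c_(k-1), the most significant one first. *)
Definition tens_digit (d k : nat) (i : 'I_(d ^ k)) (l : 'I_k) : nat :=
  ((i %/ d ^ (k - l.+1)) %% d)%N.

(* The permutation of the k tensor factors given by s. *)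
Definition tens_perm_mx (R : realType) (d k : nat) (s : 'S_k)
    : 'M[R[i]]_(d ^ k) :=
  \matrix_(i, j) [forall l, tens_digit i l == tens_digit j (s l)]%:R.

(* The tensors fixed by all the permutations of the factors, as a row space. *)
Definition sym_subspace (R : realType) (d k : nat) : 'M[R[i]]_(d ^ k) :=
  (\bigcap_(s : 'S_k) eigenspace (tens_perm_mx R d s) 1)%MS.

(* proj_ortho acts on row vectors, and is thus the transpose of the projector
   acting on column vectors; the two coincide here, the projector being
   Hermitian and the symmetric subspace stable under conjugation. *)
Definition P_sym (R : realType) (d k : nat) : 'M[R[i]]_(d ^ k) :=
  proj_ortho (sym_subspace R d k).

Definition is_design_povm (R : realType) (d N t : nat)
    (pi : 'I_N -> 'M[R[i]]_d) : Prop :=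
  is_povm pi /\
  forall k : nat, (1 <= k <= t)%N ->
    \sum_y (\tr (pi y) ^+ (k - 1))^-1 *: mxtens.ntensmx (pi y) k
    = (d%:R * ('C(d - 1 + k, k))%:R^-1) *: P_sym R d k.

(* The trace of a product of two positive semidefinite matrices is real. *)
Definition joint_prob (R : realType) (d N : nat) (T : Type)
    (rho : T -> 'M[R[i]]_d) (pi : 'I_N -> 'M[R[i]]_d) (x : T) (y : 'I_N) : R :=
  complex.Re (\tr (rho x *m pi y)).

Definition is_ensemble (R : realType) (d : nat) (rho : R -> 'M[R[i]]_d)
    : Prop :=
  [/\ forall i j, measurable_fun setT (fun x => complex.Re (rho x i j)) /\
                  measurable_fun setT (fun x => complex.Im (rho x i j)),
      forall x, psd (rho x),
      forall x, complex.Re (\tr (rho x)) <= 1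
    & (\int[lebesgue_measure]_x (complex.Re (\tr (rho x)))%:E)%E = 1%E].

Definition is_finite_ensemble (R : realType) (d M : nat)
    (rho : 'I_M -> 'M[R[i]]_d) : Prop :=
  (forall x, psd (rho x)) /\ \sum_x \tr (rho x) = 1.

(* The convention 0 ln 0 = 0 holds since a product with 0 vanishes; terms with
   pxy > 0 and px * py = 0 only occur on a null set of x. *)
Definition info_term (R : realType) (pxy px py : R) : R :=
  pxy * ln (pxy / (px * py)).

Definition mutual_info (R : realType) (d N : nat) (rho : R -> 'M[R[i]]_d)
    (pi : 'I_N -> 'M[R[i]]_d) : \bar R :=
  let p := joint_prob rho pi in
  let pX x := \sum_y p x y in
  let pY y := Rintegral lebesgue_measure setT (fun x => p x y) in
  (\int[lebesgue_measure]_x (\sum_y info_term (p x y) (pX x) (pY y))%:E)%E.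

Definition finite_mutual_info (R : realType) (d N M : nat)
    (rho : 'I_M -> 'M[R[i]]_d) (pi : 'I_N -> 'M[R[i]]_d) : R :=
  let p := joint_prob rho pi in
  let pX x := \sum_y p x y in
  let pY y := \sum_x p x y in
  \sum_x \sum_y info_term (p x y) (pX x) (pY y).

Definition informational_power (R : realType) (d N : nat)
    (pi : 'I_N -> 'M[R[i]]_d) : \bar R :=
  ereal_sup
    ([set I | exists2 rho : R -> 'M[R[i]]_d,
                is_ensemble rho & I = mutual_info rho pi] `|`
     [set I | exists M : nat, exists2 rho : 'I_M -> 'M[R[i]]_d,
                is_finite_ensemble rho & I = (finite_mutual_info rho pi)%:E]).

(* Main.v *)
(* A state [rho_x] of Bloch vector [r] with [|r| <= 1] induces the outcome
   distribution [q_y = (1 + r . n_y) / 4], and the 2-design property gives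
   [\sum_y q_y ^ 2 = (1 + |r| ^ 2 / 3) / 4 <= 1 / 3]. Since
   [ln u <= ln (4 / 3) + 3 u / 4 - 1], applied at [u = 4 q_y], this yields
   [\sum_y q_y ln (4 q_y) <= ln (4 / 3)]. Averaging over [x], and discarding the
   relative entropy of the outcome marginal with respect to the uniform law,
   bounds the mutual information by [ln (4 / 3)]. For the anti-tetrahedral
   ensemble, [q] is uniform on three outcomes and so is each marginal on four,
   so that all these inequalities are equalities. *)
Require Import Defs.
From mathcomp Require Import all_boot all_order all_algebra all_fingroup.
From mathcomp Require Import all_classical all_reals all_analysis.
From mathcomp.real_closed Require Import complex.
From mathcomp Require Import measurable_realfun ring lra.
From mathcomp.real_closed Require mxtens.

Set Implicit Arguments.
Unset Strict Implicit.
Unset Printing Implicit Defensive.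
Import Order.TTheory GRing.Theory Num.Theory.
Local Open Scope ring_scope.
Local Open Scope sesquilinear_scope.

(** * Geometry of the regular tetrahedron *)

Lemma eucl_norm_sqr (R : realType) (k : nat) (u : 'rV[R]_k) :
  eucl_norm u ^+ 2 = \sum_(l < k) u 0 l ^+ 2.
Proof. by rewrite sqr_sqrtr// sumr_ge0// => l _; exact: sqr_ge0. Qed.

(* The k+1 vectors are linearly dependent; pairing a dependence relation with
   each of them forces all its coefficients to be equal. *)
Lemma equiangular_cos (F : fieldType) (k : nat) (n : 'I_k.+1 -> 'rV[F]_k)
    (a c : F) :
  a != c ->
  (forall y z, (n y *m (n z)^T) 0 0 = if y == z then a else c) ->
  a + k%:R * c = 0.
Proof.
move=> aDc gram.
pose M := \matrix_y n y.
have /rowV0Pn[v /sub_kermxP vM0 v0] : kermx M != 0.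
  by rewrite kermx_eq0 /row_free neq_ltn ltnS rank_leq_col.
have nv z : (a - c) * v 0 z + c * \sum_y v 0 y = 0.
  have : (v *m M *m (n z)^T) 0 0 = 0 by rewrite vM0 mul0mx mxE.
  have -> : v *m M = \sum_y v 0 y *: n y.
    by rewrite mulmx_sum_row; apply: eq_bigr => y _; rewrite rowK.
  rewrite mulmx_suml summxE (bigD1 z)//= -scalemxAl mxE gram eqxx.
  rewrite (eq_bigr (fun y => v 0 y * c)); last first.
    by move=> y /negPf yz; rewrite -scalemxAl mxE gram yz.
  have -> : \sum_y v 0 y = v 0 z + \sum_(y | y != z) v 0 y by exact: bigD1.
  by rewrite -mulr_suml => dot0; rewrite -[RHS]dot0; ring.
have vE z : v 0 z = v 0 ord0.
  have := etrans (nv z) (esym (nv ord0)) => /addIr /mulfI; apply.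
  by rewrite subr_eq0.
have v00 : v 0 ord0 != 0.
  apply: contra_neq v0 => v00; apply/rowP => z.
  by rewrite vE v00 mxE.
(* With all coefficients equal to [v 0 ord0], the relation [nv] reads [(a + k c) v 0 ord0 = 0]. *)
apply/(mulfI v00); rewrite mulr0 -[RHS](nv ord0).
rewrite (eq_bigr (fun=> v 0 ord0)) => [|y _]; last exact: vE.
by rewrite sumr_const card_ord; ring.
Qed.

(* The Gram matrix of [n] being (4/3) 1 - (1/3) J, the frame operator
   S = \sum_y n_y^T n_y satisfies S^2 = (4/3) S and has trace 4, so that the
   Frobenius norm of S - 4/3 vanishes. *)
Lemma tetrahedron_moments (R : realType) (n : 'I_4 -> 'rV[R]_3) :
  inscribed_regular_tetrahedron n ->
  [/\ forall y z, \sum_(l < 3) n y 0 l * n z 0 l = if y == z then 1 else - 3^-1,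
      forall l, \sum_y n y 0 l = 0
    & forall l m, \sum_y n y 0 l * n y 0 m = if l == m then 4 / 3 else 0].
Proof.
move=> [n1 [a a0 na]].
have nn y : \sum_(l < 3) n y 0 l * n y 0 l = 1.
  by rewrite -[RHS](expr1n _ 2) -(n1 y) eucl_norm_sqr.
have nz y z : y != z -> \sum_(l < 3) n y 0 l * n z 0 l = 1 - a ^+ 2 / 2.
  move=> yz; rewrite -(na y z yz) eucl_norm_sqr.
  rewrite [X in X / 2](eq_bigr (fun l => n y 0 l * n y 0 l + n z 0 l * n z 0 l
                             - 2 * (n y 0 l * n z 0 l))); last first.
    by move=> l _; rewrite !mxE; ring.
  by rewrite sumrB big_split/= !nn -mulr_sumr; lra.
have gram0 y z : \sum_(l < 3) n y 0 l * n z 0 l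
    = if y == z then 1 else 1 - a ^+ 2 / 2.
  by case: eqVneq => [->//|/nz].
have a2 : 1 - a ^+ 2 / 2 = - 3^-1.
  (* The common cosine [c] differs from 1 because [a > 0], so four vectors in dimension three give
     [1 + 3 c = 0]. *)
  have : 1 + 3%:R * (1 - a ^+ 2 / 2) = 0; last lra.
  apply: (@equiangular_cos _ 3 n).
    by have := exprn_gt0 2 a0 => ?; apply/eqP; lra.
  move=> y z; rewrite -gram0 mxE; apply: eq_bigr => l _.
  by rewrite !mxE.
have gram y z : \sum_(l < 3) n y 0 l * n z 0 l = if y == z then 1 else - 3^-1.
  by rewrite gram0 a2.
have row_sum z : \sum_y \sum_(l < 3) n y 0 l * n z 0 l = 0.
  rewrite (eq_bigr _ (fun y _ => gram y z)) (bigD1 z)//= eqxx.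
  rewrite (eq_bigr (fun=> - 3^-1)) => [|y /negPf -> //].
  by rewrite sumr_const cardC1 card_ord -mulr_natr/=; lra.
have sum0 l : \sum_y n y 0 l = 0.
  (* The squared length of [\sum_y n_y] is the sum of all Gram entries, and each Gram row sums to
     [1 - 3 / 3 = 0]. *)
  have : \sum_(l < 3) (\sum_y n y 0 l) ^+ 2 = 0.
    transitivity (\sum_z \sum_y \sum_(l < 3) n y 0 l * n z 0 l).
      under [RHS]eq_bigr do rewrite exchange_big/=.
      rewrite exchange_big/=; apply: eq_bigr => m _.
      by rewrite expr2 mulr_sumr; apply: eq_bigr => z _; rewrite mulr_suml.
    by rewrite big1.
  move/eqP; rewrite psumr_eq0; last by move=> m _; exact: sqr_ge0.
  by move/allP/(_ l (mem_index_enum _)); rewrite sqrf_eq0 => /eqP.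
split => //.
pose S l m := \sum_y n y 0 l * n y 0 m.
have S2 l m : \sum_k S l k * S k m = 4 / 3 * S l m.
  transitivity
      (\sum_y \sum_z n y 0 l * n z 0 m * \sum_(k < 3) n y 0 k * n z 0 k).
    under eq_bigr do rewrite mulr_suml.
    rewrite exchange_big/=; apply: eq_bigr => y _.
    under eq_bigr do rewrite mulr_sumr.
    rewrite exchange_big/=; apply: eq_bigr => z _.
    by rewrite mulr_sumr; apply: eq_bigr => k _; ring.
  rewrite mulr_sumr; apply: eq_bigr => y _.
  (* The Gram matrix is [- 1/3] everywhere plus [4/3] on the diagonal; the constant part vanishes
     because [\sum_z n_z = 0]. *)
  transitivity (\sum_z (- 3^-1 * n y 0 l * n z 0 m
      + if z == y then 4 / 3 * (n y 0 l * n y 0 m) else 0)).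
    apply: eq_bigr => z _; rewrite gram eq_sym; case: eqVneq => [->|_]; lra.
  rewrite big_split/= -mulr_sumr sum0 mulr0 add0r.
  by rewrite -big_mkcond big_pred1_eq.
have trS : \sum_l S l l = 4.
  by rewrite exchange_big/= (eq_bigr _ (fun y _ => nn y)) sumr_const card_ord.
have frob : \sum_l \sum_m (S l m - if l == m then 4 / 3 else 0) ^+ 2 = 0.
  (* By [S2] and the symmetry of [S], row [l] contributes [16/9 - 4/3 S l l]; the trace makes the
     total [16/3 - 16/3]. *)
  transitivity (\sum_l (16 / 9 - 4 / 3 * S l l)); last first.
    rewrite sumrB -[X in _ - X]mulr_sumr trS sumr_const card_ord -mulr_natr.
    lra.
  apply: eq_bigr => l _.
  transitivity (\sum_m (S l m * S m l
      + if m == l then 16 / 9 - 8 / 3 * S l l else 0)).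
    apply: eq_bigr => m _.
    have -> : S m l = S l m by apply: eq_bigr => y _; rewrite mulrC.
    by rewrite eq_sym; case: eqVneq => [->|_]; lra.
  by rewrite big_split/= S2 -big_mkcond big_pred1_eq; lra.
move=> l m; apply/eqP; rewrite -subr_eq0 -sqrf_eq0; apply/eqP.
have sq_ge0 i j : 0 <= (S i j - if i == j then 4 / 3 else 0) ^+ 2.
  exact: sqr_ge0.
have /eqP := frob; rewrite psumr_eq0 => [|i _]; last exact: sumr_ge0.
move=> /allP/(_ l (mem_index_enum _)); rewrite psumr_eq0//.
by move=> /allP/(_ m (mem_index_enum _))/eqP.
Qed.

(** * Bloch vectors *)

Lemma conjCE (R : realType) (x : R[i]) : x^* = conjc x.
Proof. by []. Qed.

Lemma sum_ord3 (V : nmodType) (F : 'I_3 -> V) : \sum_l F l = F 0 + F 1 + F 2.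
Proof.
rewrite !big_ord_recl big_ord0 addr0 addrA.
by congr (F _ + F _ + F _); exact: val_inj.
Qed.

Lemma sum_ord2 (V : nmodType) (F : 'I_2 -> V) : \sum_l F l = F 0 + F 1.
Proof.
by rewrite !big_ord_recl big_ord0 addr0; congr (F _ + F _); exact: val_inj.
Qed.

Lemma ord2P (i : 'I_2) : i = 0 \/ i = 1.
Proof. by case: i => -[|[|//]] ?; [left | right]; exact: val_inj. Qed.

Lemma mx2P (K : Type) (A B : 'M[K]_2) :
  A 0 0 = B 0 0 -> A 0 1 = B 0 1 -> A 1 0 = B 1 0 -> A 1 1 = B 1 1 -> A = B.
Proof.
by move=> *; apply/matrixP => i j; case: (ord2P i) => ->; case: (ord2P j) => ->.
Qed.

Section BlochVectors.
Variable R : realType.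
Implicit Types (s t : R) (u v : 'rV[R]_3).
Local Notation C := R[i].

(** Real coordinates on Hermitian 2x2 matrices: the eigenvalues are [t - |u|] and [t + |u|], so
    positivity becomes [|u| <= t]. *)
Definition bloch t u : 'M[C]_2 := t%:C%C *: 1%:M + dot_pauli u.

Lemma blochE t u : bloch t u =
  mx2 (Complex (t + u 0 2) 0) (Complex (u 0 0) (- u 0 1))
      (Complex (u 0 0) (u 0 1)) (Complex (t - u 0 2) 0).
Proof.
rewrite /bloch /dot_pauli sum_ord3 /pauli/=.
apply: mx2P; rewrite !mxE/=; apply/eqP; rewrite eq_complex/=; apply/andP; split;
  apply/eqP; rewrite ?mulr0n ?mulr1n/=; ring.
Qed.

Lemma bloch_scale t s u : t%:C%C *: bloch s u = bloch (t * s) (t *: u).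
Proof.
rewrite !blochE; apply: mx2P; rewrite !mxE/=; apply/eqP;
  rewrite eq_complex/=; apply/andP; split; apply/eqP; ring.
Qed.

Lemma vertex_povmE (N : nat) (n : 'I_N -> 'rV[R]_3) y :
  vertex_povm n y = bloch N%:R^-1 (N%:R^-1 *: n y).
Proof.
rewrite -[X in bloch X]mulr1 -bloch_scale /vertex_povm /bloch scale1r.
by rewrite fmorphV rmorph_nat.
Qed.

Lemma anti_ensembleE (N : nat) (n : 'I_N -> 'rV[R]_3) x :
  anti_ensemble n x = bloch (2 * N)%:R^-1 (- (2 * N)%:R^-1 *: n x).
Proof.
rewrite scaleNr -scalerN -[X in bloch X]mulr1 -bloch_scale.
rewrite /anti_ensemble /bloch scale1r fmorphV rmorph_nat; congr (_ *: (_ + _)).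
rewrite /dot_pauli -sumrN; apply: eq_bigr => l _.
by rewrite mxE rmorphN scaleNr.
Qed.

Lemma bloch_sum (I : finType) (t : I -> R) (u : I -> 'rV[R]_3) :
  \sum_i bloch (t i) (u i) = bloch (\sum_i t i) (\sum_i u i).
Proof.
rewrite big_split/= -scaler_suml -rmorph_sum; congr (_ + _).
rewrite exchange_big; apply: eq_bigr => l _.
by rewrite -scaler_suml -rmorph_sum summxE.
Qed.

Lemma tr_bloch t u : \tr (bloch t u) = (2 * t)%:C%C.
Proof.
rewrite blochE /mxtrace sum_ord2 !mxE/=; apply/eqP.
by rewrite eq_complex/=; apply/andP; split; apply/eqP; ring.
Qed.

Lemma tr_bloch_mul s t u v :
  \tr (bloch s u *m bloch t v)
  = (2 * (s * t + \sum_(l < 3) u 0 l * v 0 l))%:C%C.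
Proof.
rewrite !blochE /mxtrace sum_ord2 !mxE !sum_ord2 sum_ord3 !mxE/=; apply/eqP.
by rewrite eq_complex/=; apply/andP; split; apply/eqP; ring.
Qed.

(** Since [(u . sigma) ^ 2 = |u| ^ 2], the two factors multiply to [s ^ 2 - t ^ 2 |u| ^ 2]. *)
Lemma bloch_mulN s t u : s ^+ 2 = t ^+ 2 * \sum_(l < 3) u 0 l ^+ 2 ->
  bloch s (- t *: u) *m bloch s (t *: u) = 0.
Proof.
move=> stu; rewrite !blochE; apply: mx2P; rewrite !mxE !sum_ord2 !mxE/=;
  move: stu; rewrite sum_ord3 => stu; apply/eqP;
  rewrite eq_complex/=; apply/andP; split; apply/eqP; lra.
Qed.

(** Cauchy-Schwarz without square roots: expand [\sum_l (t u_l + s v_l) ^ 2 >= 0], bound the squares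
    and divide by [2 s t]. If [s] or [t] is 0, the corresponding vector vanishes. *)
Lemma dot_ge_opp (k : nat) s t (u v : 'rV[R]_k) : 0 <= s -> 0 <= t ->
  \sum_l u 0 l ^+ 2 <= s ^+ 2 -> \sum_l v 0 l ^+ 2 <= t ^+ 2 ->
  0 <= s * t + \sum_l u 0 l * v 0 l.
Proof.
have null (w : 'rV[R]_k) : \sum_l w 0 l ^+ 2 <= 0 ^+ 2 -> w = 0.
  rewrite expr0n/= => w0; apply/rowP => l; rewrite mxE.
  have /eqP : \sum_l w 0 l ^+ 2 = 0.
    by apply/eqP; rewrite eq_le w0 sumr_ge0// => i _; exact: sqr_ge0.
  rewrite psumr_eq0 => [|i _]; last exact: sqr_ge0.
  by move=> /allP/(_ l (mem_index_enum _)); rewrite sqrf_eq0 => /eqP.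
rewrite le_eqVlt => /predU1P[<-|s0].
  move=> _ /null -> _; rewrite mul0r add0r sumr_ge0// => l _.
  by rewrite mxE mul0r.
rewrite le_eqVlt => /predU1P[<-|t0].
  move=> _ /null ->; rewrite mulr0 add0r sumr_ge0// => l _.
  by rewrite mxE mulr0.
move=> us vt; have st0 := mulr_gt0 s0 t0.
rewrite -(pmulr_rge0 _ st0).
have : 0 <= \sum_l (t * u 0 l + s * v 0 l) ^+ 2.
  by apply: sumr_ge0 => l _; exact: sqr_ge0.
rewrite (eq_bigr (fun l => t ^+ 2 * u 0 l ^+ 2 + s ^+ 2 * v 0 l ^+ 2
    + 2 * (s * t) * (u 0 l * v 0 l))) => [|l _]; last by ring.
rewrite !big_split/= -!mulr_sumr => sq_ge0.
have : t ^+ 2 * \sum_l u 0 l ^+ 2 <= t ^+ 2 * s ^+ 2.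
  by rewrite ler_wpM2l ?sqr_ge0.
have : s ^+ 2 * \sum_l v 0 l ^+ 2 <= s ^+ 2 * t ^+ 2.
  by rewrite ler_wpM2l ?sqr_ge0.
lra.
Qed.

Lemma bloch_herm t u : bloch t u \is hermsymmx.
Proof.
apply/is_hermitianmxP; rewrite expr0 scale1r blochE.
apply: mx2P; rewrite !mxE/= conjCE; apply/eqP; rewrite eq_complex/=;
  apply/andP; split; apply/eqP; ring.
Qed.

Lemma hermP (A : 'M[C]_2) : A \is hermsymmx -> exists t u, A = bloch t u.
Proof.
move=> /is_hermitianmxP; rewrite expr0 scale1r => Aherm.
have A00 := congr1 (fun B : 'M[C]_2 => B 0 0) Aherm.
have A01 := congr1 (fun B : 'M[C]_2 => B 0 1) Aherm.
have A11 := congr1 (fun B : 'M[C]_2 => B 1 1) Aherm.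
rewrite !mxE !conjCE in A00 A01 A11.
exists ((complex.Re (A 0 0) + complex.Re (A 1 1)) / 2).
exists (\row_l if l == 0 then complex.Re (A 1 0)
               else if l == 1 then complex.Im (A 1 0)
               else (complex.Re (A 0 0) - complex.Re (A 1 1)) / 2).
rewrite blochE; apply: mx2P; rewrite !mxE/=.
- move: A00; case: (A 0 0) => a b /(congr1 (@complex.Im R))/= b0.
  by congr Complex; lra.
- by rewrite A01; case: (A 1 0).
- by case: (A 1 0).
- move: A11; case: (A 1 1) => a b /(congr1 (@complex.Im R))/= b0.
  by congr Complex; lra.
Qed.

(** The coefficients of the [u 0 l] are the real numbers [v^t* sigma_l v], the coordinates of the
    Hopf map at [v]. *)
Lemma bloch_qf t u (v : 'cV[C]_2) :
  let x1 := complex.Re (v 0 0) in let y1 := complex.Im (v 0 0) in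
  let x2 := complex.Re (v 1 0) in let y2 := complex.Im (v 1 0) in
  (v^t* *m bloch t u *m v) 0 0
  = Complex (t * (x1 ^+ 2 + y1 ^+ 2 + x2 ^+ 2 + y2 ^+ 2)
      + (u 0 0 * (2 * (x1 * x2 + y1 * y2)) + u 0 1 * (2 * (x1 * y2 - y1 * x2))
         + u 0 2 * (x1 ^+ 2 + y1 ^+ 2 - x2 ^+ 2 - y2 ^+ 2))) 0.
Proof.
rewrite !mxE !sum_ord2 !mxE !sum_ord2 blochE !mxE/= !conjCE.
case: (v 0 0) (v 1 0) => [x1 y1] [x2 y2] /=; apply/eqP; rewrite eq_complex/=.
by apply/andP; split; apply/eqP; ring.
Qed.

Lemma psd_bloch t u : 0 <= t -> \sum_(l < 3) u 0 l ^+ 2 <= t ^+ 2 ->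
  psd (bloch t u).
Proof.
move=> t0 ut; split=> [|v]; first exact: bloch_herm.
rewrite bloch_qf lecE/= eqxx/=.
case: (v 0 0) (v 1 0) => [x1 y1] [x2 y2] /=.
(* The Hopf image of the test vector has length exactly the squared norm of that vector, as
   [dot_ge_opp] requires. *)
pose w : 'rV[R]_3 := \row_l
  if l == 0 then 2 * (x1 * x2 + y1 * y2)
  else if l == 1 then 2 * (x1 * y2 - y1 * x2)
  else x1 ^+ 2 + y1 ^+ 2 - x2 ^+ 2 - y2 ^+ 2.
have := @dot_ge_opp 3 t (x1 ^+ 2 + y1 ^+ 2 + x2 ^+ 2 + y2 ^+ 2) u w t0.
rewrite !sum_ord3 !mxE/=; apply; first by rewrite !addr_ge0 ?sqr_ge0.
  by move: ut; rewrite sum_ord3.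
by rewrite le_eqVlt; apply/orP; left; apply/eqP; ring.
Qed.

Lemma psd_blochP (A : 'M[C]_2) : psd A -> exists t u,
  [/\ A = bloch t u, 0 <= t & \sum_(l < 3) u 0 l ^+ 2 <= t ^+ 2].
Proof.
move=> [/hermP[t [u ->]] qf_ge0]; exists t, u.
have qf x1 y1 x2 y2 :
    0 <= t * (x1 ^+ 2 + y1 ^+ 2 + x2 ^+ 2 + y2 ^+ 2)
      + (u 0 0 * (2 * (x1 * x2 + y1 * y2)) + u 0 1 * (2 * (x1 * y2 - y1 * x2))
         + u 0 2 * (x1 ^+ 2 + y1 ^+ 2 - x2 ^+ 2 - y2 ^+ 2)).
  have := qf_ge0 (\col_i if i == 0 then Complex x1 y1 else Complex x2 y2).
  by rewrite bloch_qf lecE !mxE/= => /andP[].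
have a0 := qf 1 0 0 0; have d0 := qf 0 0 1 0.
have t0 : 0 <= t by lra.
split => //; rewrite sum_ord3.
move: t0; rewrite le_eqVlt => /predU1P[t0|t0].
  (* For [t = 0], the basis vectors force [u_2 = 0], and this test vector gives
     [- 2 (u_0 ^ 2 + u_1 ^ 2) >= 0]. *)
  have := qf (- u 0 0) (u 0 1) 1 0.
  by rewrite -t0 in a0 d0 *; nra.
(* The test vectors are the columns of the adjugate: the forms equal [(t + u_2) D] and [(t - u_2) D]
   with [D = t ^ 2 - |u| ^ 2] the determinant, and they add up to [2 t D]. *)
have q1 := qf (- u 0 0) (u 0 1) (t + u 0 2) 0.
have q2 := qf (t - u 0 2) 0 (- u 0 0) (- u 0 1).
by rewrite -subr_ge0 -(pmulr_rge0 _ t0); lra.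
Qed.

End BlochVectors.

(** * Projectors onto symmetric subspaces *)

Lemma adjmxM (R : realType) (m n p : nat) (A : 'M[R[i]]_(m, n))
    (B : 'M[R[i]]_(n, p)) : (A *m B) ^t* = B ^t* *m A ^t*.
Proof. by rewrite trmx_mul map_mxM. Qed.

(** As [P] is Hermitian and fixes symmetric tensors, the rows of [1 - P] are orthogonal to them and
    [P_sym] kills [1 - P]. The rows of [P] are themselves symmetric, so [P_sym] fixes [P]; both
    sides thus equal [P *m P_sym]. *)
Lemma P_sym_unique (R : realType) (d k : nat) (P : 'M[R[i]]_(d ^ k)) :
  P ^t* = P -> (forall s, P *m tens_perm_mx R d s = P) ->
  (forall u : 'rV_(d ^ k), (forall s : 'S_k, u *m tens_perm_mx R d s = u) ->
    u *m P = u) ->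
  P_sym R d k = P.
Proof.
move=> Pherm Pfix fixP; set U := sym_subspace R d k.
have PU : (P <= U)%MS.
  by apply/sub_bigcapmxP => s _; apply/eigenspaceP; rewrite Pfix scale1r.
have UP (m : nat) (W : 'M[R[i]]_(m, (d ^ k)%N)) : (W <= U)%MS -> W *m P = W.
  move=> WU; apply/row_matrixP => i; rewrite row_mul; apply: fixP => s.
  have /sub_bigcapmxP/(_ s isT)/eigenspaceP := submx_trans (row_sub i W) WU.
  by rewrite scale1r.
have P0 : (1%:M - P) *m P_sym R d k = 0.
  apply: proj_ortho_0; apply/orthomx1P; rewrite -/U.
  rewrite -[U in U ^t*](UP _ U (submx_refl _)) adjmxM Pherm mulmxA mulmxBl.
  by rewrite mul1mx (UP _ P PU) subrr mul0mx.
by rewrite -[LHS]mul1mx -[1%:M](subrK P) mulmxDl P0 add0r proj_ortho_id.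
Qed.

Lemma P_sym1 (R : realType) (d : nat) : P_sym R d 1 = 1%:M.
Proof.
have T1 (s : 'S_1) : tens_perm_mx R d s = 1%:M.
  apply/matrixP => i j; rewrite !mxE; congr (_%:R); congr (nat_of_bool _).
  apply/forallP/eqP => [/(_ ord0)|-> l].
    have dg (x : 'I_(d ^ 1)) : tens_digit x (0 : 'I_1) = x.
      by rewrite /tens_digit subnn expn0 divn1 modn_small// -[ltnRHS]expn1.
    by rewrite [s _]ord1 !dg => /eqP; exact: val_inj.
  by rewrite [l]ord1 [s _]ord1.
by apply: P_sym_unique => [|s|u _]; rewrite ?T1 ?mulmx1// trmx1 map_mx1.
Qed.

Lemma forall_ord2 (P : pred 'I_2) : [forall l, P l] = P 0 && P 1.
Proof.
apply/forallP/andP => [P2|[P0 P1] l]; first by split.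
by case: (ord2P l) => ->.
Qed.

Lemma perm2P (s : 'S_2) : s = 1%g \/ s = tperm 0 1.
Proof.
case: (ord2P (s 0)) => s0; [left|right]; apply/permP => l;
  rewrite ?perm1 ?permE/=; case: (ord2P l) => ->; rewrite ?s0//=.
  case: (ord2P (s 1)) => // s1.
  by have := perm_inj (etrans s0 (esym s1)).
case: (ord2P (s 1)) => // s1.
by have := perm_inj (etrans s0 (esym s1)).
Qed.

Section TwoFactors.
Variables (R : realType) (d : nat).
Implicit Types (i j k l : 'I_d).

(** [d ^ 2] computes to [d * d], so the index of a pair is also a tensor index, with digits [i] and
    [j]. *)
Local Notation idx i j := (mxtens.mxtens_index (i, j) : 'I_(d ^ 2)).

Lemma tens_digit0 i j : tens_digit (idx i j) (0 : 'I_2) = i.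
Proof.
rewrite /tens_digit/= subn1 expn1 divnMDl ?(leq_ltn_trans _ (ltn_ord i))//.
by rewrite divn_small// addn0 modn_small.
Qed.

Lemma tens_digit1 i j : tens_digit (idx i j) (1 : 'I_2) = j.
Proof. by rewrite /tens_digit/= subnn expn0 divn1 modnMDl modn_small. Qed.

Lemma tens_perm_mx2_1 i j k l :
  tens_perm_mx R d (1%g : 'S_2) (idx i j) (idx k l) = ((i == k) && (j == l))%:R.
Proof. by rewrite mxE forall_ord2 !perm1 !tens_digit0 !tens_digit1. Qed.

Lemma tens_perm_mx2_swap i j k l :
  tens_perm_mx R d (tperm 0 1 : 'S_2) (idx i j) (idx k l)
  = ((i == l) && (j == k))%:R.
Proof. by rewrite mxE forall_ord2 tpermL tpermR !tens_digit0 !tens_digit1. Qed.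

Lemma eq_idx i j k l : (idx i j == idx k l) = (i == k) && (j == l).
Proof.
by rewrite (can_eq (@mxtens.mxtens_indexK _ _)) -pair_eqE.
Qed.

Let swap_idx (a : 'I_(d ^ 2)) : 'I_(d ^ 2) :=
  let p := mxtens.mxtens_unindex (a : 'I_(d * d)) in idx p.2 p.1.

Let swapE a b :
  tens_perm_mx R d (tperm 0 1 : 'S_2) a b = (b == swap_idx a)%:R.
Proof.
case: (mxtens.mxtens_indexP (a : 'I_(d * d))) => i j.
case: (mxtens.mxtens_indexP (b : 'I_(d * d))) => k l.
by rewrite tens_perm_mx2_swap /swap_idx mxtens.mxtens_indexK eq_idx andbC
  [k == _]eq_sym [l == _]eq_sym.
Qed.

Lemma tens_perm_mx_id : tens_perm_mx R d (1%g : 'S_2) = 1%:M.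
Proof.
apply/matrixP => a b.
case: (mxtens.mxtens_indexP (a : 'I_(d * d))) => i j.
case: (mxtens.mxtens_indexP (b : 'I_(d * d))) => k l.
by rewrite tens_perm_mx2_1 mxE eq_idx.
Qed.

Lemma tens_perm_mx_swap_sqr :
  tens_perm_mx R d (tperm 0 1 : 'S_2) *m tens_perm_mx R d (tperm 0 1) = 1%:M.
Proof.
apply/matrixP => a b; rewrite mxE (bigD1 (swap_idx a))//= big1 => [|c ca].
  rewrite !swapE eqxx mul1r addr0.
  have -> : swap_idx (swap_idx a) = a.
    rewrite {1}/swap_idx mxtens.mxtens_indexK.
    exact: (@mxtens.mxtens_unindexK d d a).
  by rewrite mxE eq_sym.
by rewrite swapE (negPf ca) mul0r.
Qed.

(** The average of the two permutations of the factors satisfies [P_sym_unique] because the swap is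
    a Hermitian involution. *)
Lemma P_sym2 :
  P_sym R d 2 = 2^-1 *: (1%:M + tens_perm_mx R d (tperm 0 1 : 'S_2)).
Proof.
set W := tens_perm_mx R d _; have W2 : W *m W = 1%:M := tens_perm_mx_swap_sqr.
have Wherm : W ^t* = W.
  apply/matrixP => a b.
  case: (mxtens.mxtens_indexP (a : 'I_(d * d))) => i j.
  case: (mxtens.mxtens_indexP (b : 'I_(d * d))) => k l.
  rewrite 2!mxE /W !tens_perm_mx2_swap conjC_nat andbC.
  by rewrite [k == _]eq_sym [l == _]eq_sym.
apply: P_sym_unique => [|s|u ufix].
- rewrite linearZ/= map_mxZ linearD/= map_mxD Wherm trmx1 map_mx1.
  by rewrite fmorphV rmorph_nat.
- have [->|->] := perm2P s; first by rewrite tens_perm_mx_id mulmx1.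
  by rewrite -scalemxAl mulmxDl mul1mx W2 addrC.
- rewrite -scalemxAr mulmxDr mulmx1 ufix -[u + u]mulr2n.
  by rewrite -[u *+ 2]scaler_nat scalerA mulVf ?scale1r// pnatr_eq0.
Qed.

End TwoFactors.

(** * The tetrahedral POVM *)

Section Tetrahedron.
Variables (R : realType) (n : 'I_4 -> 'rV[R]_3).
Hypothesis hn : inscribed_regular_tetrahedron n.

Let gram y z : \sum_(l < 3) n y 0 l * n z 0 l = if y == z then 1 else - 3^-1.
Proof. by case: (tetrahedron_moments hn). Qed.

Let sum1 l : \sum_y n y 0 l = 0.
Proof. by case: (tetrahedron_moments hn). Qed.

Let sum2 l m : \sum_y n y 0 l * n y 0 m = if l == m then 4 / 3 else 0.
Proof. by case: (tetrahedron_moments hn). Qed.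

Let sqr y : \sum_(l < 3) n y 0 l ^+ 2 = 1.
Proof. by under eq_bigr do rewrite expr2; rewrite gram eqxx. Qed.

Let scaled_sqr (c : R) y : \sum_(l < 3) (c *: n y) 0 l ^+ 2 = c ^+ 2.
Proof.
under eq_bigr do rewrite mxE exprMn.
by rewrite -mulr_sumr sqr mulr1.
Qed.

Lemma tetra_is_povm : is_povm (vertex_povm n).
Proof.
split=> [y|].
  by rewrite vertex_povmE; apply: psd_bloch; rewrite ?invr_ge0// scaled_sqr.
under eq_bigr do rewrite vertex_povmE.
rewrite bloch_sum -scaler_sumr.
have -> : \sum_y n y = 0 by apply/rowP => l; rewrite summxE sum1 mxE.
rewrite sumr_const card_ord -[_ *+ 4]mulr_natl mulfV ?pnatr_eq0//.
rewrite scaler0 /bloch scale1r /dot_pauli big1 ?addr0// => l _.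
by rewrite mxE scale0r.
Qed.

Lemma tr_tetra y : \tr (vertex_povm n y) = 2^-1.
Proof.
rewrite vertex_povmE tr_bloch -[RHS](_ : (2^-1)%:C%C = _); last first.
  by rewrite fmorphV rmorph_nat.
by congr (_%:C%C); lra.
Qed.

(** Entrywise form of [\sum_y pi_y (x) pi_y = (1 + W) / 6], with [W] the swap: the first moments
    cancel, and the second moments leave [\sum_l sigma_l (x) sigma_l = 2 W - 1]. The sixteen entries
    are checked from the moments. *)
Lemma tetra_tens2 (i j k l : 'I_2) :
  \sum_y vertex_povm n y i k * vertex_povm n y j l
  = 6^-1 * (((i == k) && (j == l))%:R + ((i == l) && (j == k))%:R).
Proof.
pose M l := \sum_y n y 0 l; pose S l m := \sum_y n y 0 l * n y 0 m.
have M0 l' : M l' = 0 by exact: sum1.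
have [S00 S11 S22] : [/\ S 0 0 = 4 / 3, S 1 1 = 4 / 3 & S 2 2 = 4 / 3].
  by rewrite /S !sum2.
have [S01 S02 S12] : [/\ S 0 1 = 0, S 0 2 = 0 & S 1 2 = 0].
  by rewrite /S !sum2.
have := (M0 0, M0 1, M0 2); move: S00 S11 S22 S01 S02 S12; rewrite /M /S.
rewrite !big_ord_recl !big_ord0 !vertex_povmE !blochE !addr0.
move=> S00 S11 S22 S01 S02 S12 [[M00 M1] M2].
have e6 : 6^-1 = (6^-1)%:C%C :> R[i] by rewrite fmorphV rmorph_nat.
by case: (ord2P i) => ->; case: (ord2P j) => ->; case: (ord2P k) => ->;
  case: (ord2P l) => ->; rewrite !mxE/= e6; apply/eqP;
  rewrite eq_complex/=; apply/andP; split; apply/eqP; lra.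
Qed.

Lemma anti_tetra_mul x : anti_ensemble n x *m vertex_povm n x = 0.
Proof.
(* Pulling out [1/2] leaves the scalar part [1/4] of the POVM element, so the two Bloch vectors
   become opposite. *)
have -> : anti_ensemble n x = 2^-1 *: bloch 4^-1 (- 4^-1 *: n x).
  rewrite anti_ensembleE -[2^-1](_ : (2^-1)%:C%C = _); last first.
    by rewrite fmorphV rmorph_nat.
  rewrite bloch_scale scalerA; congr (bloch _ (_ *: _)); lra.
rewrite vertex_povmE -scalemxAl bloch_mulN ?scaler0// sqr mulr1.
by [].
Qed.

Lemma anti_tetra_is_finite_ensemble : is_finite_ensemble (anti_ensemble n).
Proof.
split=> [x|].
  rewrite anti_ensembleE; apply: psd_bloch; rewrite ?invr_ge0//.
  by rewrite scaled_sqr sqrrN.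
under eq_bigr do rewrite anti_ensembleE tr_bloch.
rewrite sumr_const card_ord -rmorphMn -[RHS](rmorph1 (real_complex R)).
by congr (_%:C%C); lra.
Qed.

(** The value is [(1 - n_x . n_y) / 16], where [n_x . n_y] is 1 or [- 1/3]. *)
Lemma anti_tetra_prob x y :
  joint_prob (anti_ensemble n) (vertex_povm n) x y
  = if x == y then 0 else 12^-1.
Proof.
rewrite /joint_prob anti_ensembleE vertex_povmE tr_bloch_mul/=.
under eq_bigr do rewrite !mxE mulrACA.
rewrite -mulr_sumr gram; case: eqP => _; lra.
Qed.

Lemma anti_tetra_info :
  finite_mutual_info (anti_ensemble n) (vertex_povm n) = ln (4 / 3).
Proof.
have marg (x : 'I_4) : \sum_y (if x == y then 0 else 12^-1) = 4^-1 :> R.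
  rewrite (bigD1 x)//= eqxx (eq_bigr (fun=> 12^-1)) => [|y].
    by rewrite sumr_const cardC1 card_ord -mulr_natr/=; lra.
  by rewrite eq_sym => /negPf ->.
rewrite /finite_mutual_info/=.
have pX x : \sum_y joint_prob (anti_ensemble n) (vertex_povm n) x y = 4^-1.
  by under eq_bigr do rewrite anti_tetra_prob; rewrite marg.
have pY y : \sum_x joint_prob (anti_ensemble n) (vertex_povm n) x y = 4^-1.
  by under eq_bigr do rewrite anti_tetra_prob eq_sym; rewrite marg.
transitivity (\sum_(x < 4)
  \sum_y (if x == y then 0 else 12^-1) * ln (4 / 3 : R)).
  apply: eq_bigr => x _; apply: eq_bigr => y _.
  rewrite pX pY anti_tetra_prob /info_term; case: eqP => _.
    by rewrite !mul0r.
  by congr (_ * ln _); lra.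
under eq_bigr do rewrite -mulr_suml marg.
by rewrite sumr_const card_ord; lra.
Qed.

Lemma tetra_is_design : is_design_povm 2 (vertex_povm n).
Proof.
split=> [|k]; first exact: tetra_is_povm.
have trV y : (\tr (vertex_povm n y))^-1 = 2 by rewrite tr_tetra invrK.
case: k => [|[|[|//]]] // _.
  under eq_bigr do rewrite subnn expr0 invr1 scale1r mxtens.ntensmx1.
  rewrite tetra_is_povm.2 P_sym1 addnC bin1 mulfV ?pnatr_eq0//.
  by rewrite scale1r.
under eq_bigr do rewrite subn1 expr1 trV mxtens.ntensmx2.
rewrite P_sym2 -scaler_sumr scalerA; apply/matrixP => a b.
case: (mxtens.mxtens_indexP (a : 'I_(2 * 2))) => i j.
case: (mxtens.mxtens_indexP (b : 'I_(2 * 2))) => k l.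
rewrite mxE summxE.
under eq_bigr do rewrite mxtens.tensmxE.
rewrite tetra_tens2 -tens_perm_mx_id [RHS]mxE [X in _ = _ * X]mxE.
rewrite tens_perm_mx2_1 tens_perm_mx2_swap mulrA; congr (_ * _).
(* Here 3 is the dimension of the symmetric subspace; both sides are [1/3] times the same matrix. *)
by rewrite (_ : 'C(2 - 1 + 2, 2) = 3)//; field.
Qed.

(** Homogeneous version for unnormalized states: [p_y = (t + u . n_y) / 2], and the moments of the
    vertices give [\sum_y p_y = 2 t] and [\sum_y p_y ^ 2 = t ^ 2 + |u| ^ 2 / 3], where
    [|u| <= t]. *)
Lemma tetra_prob (A : 'M[R[i]]_2) : psd A ->
  let p y := complex.Re (\tr (A *m vertex_povm n y)) in
  [/\ forall y, 0 <= p y, \sum_y p y = complex.Re (\tr A)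
    & \sum_y p y ^+ 2 <= (\sum_y p y) ^+ 2 / 3].
Proof.
move=> /psd_blochP[t [u [-> t0 ut]]] p.
have pE y : p y = (t + \sum_(l < 3) u 0 l * n y 0 l) / 2.
  rewrite /p vertex_povmE tr_bloch_mul/=.
  under eq_bigr do rewrite mxE mulrCA.
  by rewrite -mulr_sumr; lra.
have sum_un : \sum_y \sum_(l < 3) u 0 l * n y 0 l = 0.
  rewrite exchange_big big1// => l _.
  by rewrite -mulr_sumr sum1 mulr0.
have sum_un2 : \sum_y (\sum_(l < 3) u 0 l * n y 0 l) ^+ 2
    = 4 / 3 * \sum_(l < 3) u 0 l ^+ 2.
  transitivity (\sum_l \sum_m u 0 l * u 0 m * \sum_y n y 0 l * n y 0 m).
    under [RHS]eq_bigr do under eq_bigr do rewrite mulr_sumr.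
    under [RHS]eq_bigr do rewrite exchange_big.
    rewrite [RHS]exchange_big; apply: eq_bigr => y _.
    rewrite expr2 mulr_suml; apply: eq_bigr => l _.
    by rewrite mulr_sumr; apply: eq_bigr => m _; rewrite mulrACA.
  rewrite mulr_sumr; apply: eq_bigr => l _.
  rewrite (bigD1 l)//= [X in _ + X]big1 ?addr0 => [|m ml].
    by rewrite sum2 eqxx mulrC expr2.
  by rewrite sum2 eq_sym (negPf ml) mulr0.
have sum_p : \sum_y p y = 2 * t.
  under eq_bigr do rewrite pE.
  by rewrite -mulr_suml big_split/= sum_un sumr_const card_ord; lra.
split.
- move=> y; rewrite pE; have := @dot_ge_opp R 3 t 1 u (n y) t0 ler01 ut.
  by rewrite sqr expr1n mulr1 => /(_ (lexx _)) ?; rewrite divr_ge0.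
- by rewrite sum_p tr_bloch.
rewrite sum_p; under eq_bigr do rewrite pE.
rewrite (eq_bigr (fun y => 4^-1 * (t ^+ 2
    + 2 * t * \sum_(l < 3) u 0 l * n y 0 l
    + (\sum_(l < 3) u 0 l * n y 0 l) ^+ 2))) => [|y _]; last by field.
rewrite -mulr_sumr !big_split/= -[X in _ * (_ + X + _)]mulr_sumr.
rewrite sum_un sum_un2.
by rewrite sumr_const card_ord; lra.
Qed.

End Tetrahedron.

(** * Mutual information *)

Section InformationBound.
Variable R : realType.
Implicit Types (m p t x : R).

Lemma ln_le_subr1 x : 0 < x -> ln x <= x - 1.
Proof. by move=> x0; rewrite -{1}(subrKC 1 x) le_ln1Dx// ltrBrDl subrr. Qed.

(* A multiplier for the marginal weight [m] of an outcome. Where [m = 0] the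
   outcome has probability 0 for almost every state, and the constant 1 makes
   the bound of [info_term_le] hold for every state. *)
Definition outcome_cost m : R := if m == 0 then 1 else - ln (4 * m).

(** The logarithm splits as [ln (4/3) + ln (3 p / t) - ln (4 m)]; the middle term is bounded by its
    tangent at [p / t = 1/3], the nonzero outcome probability for the anti-tetrahedral states. *)
Lemma info_term_le p t m : 0 <= p -> p <= t -> 0 <= m ->
  info_term p t m
  <= p * ln (4 / 3) + p * outcome_cost m + (3 * (p ^+ 2 / t) - p).
Proof.
rewrite /info_term le_eqVlt => /predU1P[<- _ _|p0 pt].
  by rewrite expr0n/= !mul0r mulr0 subrr !addr0.
have t0 : 0 < t by exact: lt_le_trans pt.
have pt0 : 0 < p / t by rewrite divr_gt0.
rewrite [p ^+ 2]expr2 -mulrA.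
have ln43 : 0 <= ln (4 / 3 : R) by apply: ln_ge0; lra.
(* At [m = 0] the quotient by 0 is 0 and [ln 0 = 0]: the left side vanishes and the right side is
   nonnegative. *)
rewrite /outcome_cost le_eqVlt => /predU1P[<-|m0].
  by rewrite eqxx mulr0 invr0 mulr0 ln0// mulr0; nra.
rewrite gt_eqF//.
have -> : p / (t * m) = 4 / 3 * (3 * (p / t)) / (4 * m).
  by field; rewrite !gt_eqF.
rewrite [ln (_ / (4 * m))]ln_div ?posrE ?mulr_gt0 ?invr_gt0//.
rewrite [ln (_ * (3 * _))]lnM ?posrE ?mulr_gt0 ?invr_gt0//.
have := @ln_le_subr1 (3 * (p / t)); rewrite mulr_gt0// => /(_ isT) lnp.
have := ler_wpM2l (ltW p0) lnp; lra.
Qed.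

(** The remainders of [info_term_le] add up to [3 (\sum_y p_y ^ 2) / t - t], which is nonpositive by
    the quadratic hypothesis. *)
Lemma info_le (N : nat) (p m : 'I_N -> R) :
  (forall y, 0 <= p y) -> (forall y, 0 <= m y) ->
  \sum_y p y ^+ 2 <= (\sum_y p y) ^+ 2 / 3 ->
  \sum_y info_term (p y) (\sum_z p z) (m y)
  <= (\sum_y p y) * ln (4 / 3) + \sum_y p y * outcome_cost (m y).
Proof.
move=> p0 m0 p2; set t := \sum_z p z in p2 *.
have t0 : 0 <= t by exact: sumr_ge0.
apply: (@le_trans _ _ (\sum_y (p y * ln (4 / 3) + p y * outcome_cost (m y)
    + (3 * (p y ^+ 2 / t) - p y)))).
  apply: ler_sum => y _; apply: info_term_le => //.
  by rewrite /t (bigD1 y)//= lerDl sumr_ge0.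
rewrite !big_split/= -mulr_suml -/t sumrN -/t gerDl.
rewrite -mulr_sumr -mulr_suml subr_le0.
(* For [t = 0] both sides vanish, the inverse of 0 being 0. *)
have [->|t1] := eqVneq t 0; first by rewrite invr0 !mulr0.
by rewrite mulrA ler_pdivrMr ?lt_def ?t1// -expr2 -ler_pdivlMl// mulrC.
Qed.

(** Gibbs' inequality against the uniform law: [- m_y ln (4 m_y) <= 1/4 - m_y], and these bounds sum
    to 0. A vanishing [m_y] contributes [0 <= 1/4]. *)
Lemma outcome_cost_le (m : 'I_4 -> R) :
  (forall y, 0 <= m y) -> \sum_y m y = 1 ->
  \sum_y m y * outcome_cost (m y) <= 0.
Proof.
move=> m0 m1; apply: (@le_trans _ _ (\sum_y (4^-1 - m y))).
  apply: ler_sum => y _; rewrite /outcome_cost.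
  case: eqVneq => [->|my]; first by rewrite mul0r subr0 invr_ge0.
  have my0 : 0 < m y by rewrite lt_def my m0.
  have := @ln_le_subr1 (4 * m y)^-1; rewrite invr_gt0 mulr_gt0//.
  rewrite lnV ?posrE ?mulr_gt0// => /(_ isT) /(ler_wpM2l (ltW my0)).
  move=> /le_trans; apply; rewrite le_eqVlt; apply/orP; left; apply/eqP.
  by field.
by rewrite sumrB m1 sumr_const card_ord; lra.
Qed.

End InformationBound.

(* No measurability is needed since both parts of the integral are suprema over
   simple functions. *)
Lemma le_integral_pointwise d (T : measurableType d) (R : realType)
    (mu : {measure set T -> \bar R}) (f g : T -> \bar R) :
  (forall x, f x <= g x)%E ->
  (\int[mu]_x f x <= \int[mu]_x g x)%E.
Proof.
move=> fg; rewrite /integral !patch_setT; apply: leeB.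
  apply: le_ereal_sup => _ [h hf <-]; exists h => // x.
  apply: (le_trans (hf x)).
  by apply: (@funepos_le _ _ setT) => [y _|]; rewrite ?inE.
apply: le_ereal_sup => _ [h hf <-]; exists h => // x.
apply: (le_trans (hf x)).
by apply: (@funeneg_le _ _ setT) => [y _|]; rewrite ?inE.
Qed.

(** * Integrability for ensembles indexed by the reals *)

Section EnsembleIntegrals.
Variables (R : realType) (rho : R -> 'M[R[i]]_2).
Hypothesis rho_ens : is_ensemble rho.
Local Notation mu := (@lebesgue_measure R).

Lemma ensemble_tr_ge0 x : 0 <= complex.Re (\tr (rho x)).
Proof.
have [_ /(_ x) /psd_blochP[t [u [-> t0 _]]] _ _] := rho_ens.
by rewrite tr_bloch/= mulr_ge0.
Qed.

Lemma measurable_tr_mul (B : 'M[R[i]]_2) :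
  measurable_fun setT (fun x => complex.Re (\tr (rho x *m B))).
Proof.
have [mrho _ _ _] := rho_ens.
rewrite (_ : (fun _ => _) = fun x => \sum_i \sum_j
  (complex.Re (rho x i j) * complex.Re (B j i)
   - complex.Im (rho x i j) * complex.Im (B j i))); last first.
  apply/funext => x; rewrite /mxtrace raddf_sum; apply: eq_bigr => i _.
  rewrite mxE raddf_sum; apply: eq_bigr => j _.
  by case: (rho x i j) (B j i) => [a b] [c e].
apply: measurable_sum => i; apply: measurable_sum => j.
by have [mRe mIm] := mrho i j; apply: measurable_funB;
  apply: measurable_funM.
Qed.

Lemma integrable_ensemble_tr :
  mu.-integrable setT (fun x => (complex.Re (\tr (rho x)))%:E).
Proof.
apply/integrableP; split.
  apply/measurable_EFinP; have := measurable_tr_mul 1%:M.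
  by under eq_fun do rewrite mulmx1.
have [_ _ _ int1] := rho_ens.
under eq_integral do rewrite gee0_abs ?lee_fin ?ensemble_tr_ge0//.
by rewrite int1 ltry.
Qed.

End EnsembleIntegrals.

(** * The informational power of the tetrahedral POVM *)

Section InformationalPower.
Variables (R : realType) (n : 'I_4 -> 'rV[R]_3).
Hypothesis hn : inscribed_regular_tetrahedron n.
Local Notation mu := (@lebesgue_measure R).
Local Notation pi := (vertex_povm n).

Lemma tetra_finite_info_le (M : nat) (rho : 'I_M -> 'M[R[i]]_2) :
  is_finite_ensemble rho -> finite_mutual_info rho pi <= ln (4 / 3).
Proof.
move=> [rho_psd tr1]; rewrite /finite_mutual_info/=.
have P x := tetra_prob hn (rho_psd x); rewrite /= in P.
set m := fun y => \sum_x joint_prob rho pi x y.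
have m0 y : 0 <= m y by apply: sumr_ge0 => x _; have [p0 _ _] := P x; exact: p0.
have tr1R : \sum_x complex.Re (\tr (rho x)) = 1.
  by have /(congr1 (@complex.Re R)) := tr1; rewrite raddf_sum.
have m1 : \sum_y m y = 1.
  rewrite exchange_big/= -[RHS]tr1R; apply: eq_bigr => x _.
  by case: (P x).
apply: (@le_trans _ _ (\sum_x (complex.Re (\tr (rho x)) * ln (4 / 3)
    + \sum_y joint_prob rho pi x y * outcome_cost (m y)))).
  apply: ler_sum => x _; have [p0 <- p2] := P x.
  exact: info_le.
(* After exchanging the sums, what is left besides [ln (4/3)] is minus the relative entropy of the
   outcome marginal to the uniform law. *)
rewrite big_split/= -mulr_suml tr1R mul1r gerDl exchange_big/=.
by under eq_bigr do rewrite -mulr_suml; exact: outcome_cost_le.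
Qed.

Lemma tetra_info_le (rho : R -> 'M[R[i]]_2) :
  is_ensemble rho -> (mutual_info rho pi <= (ln (4 / 3))%:E)%E.
Proof.
move=> ens; have [_ rho_psd _ int1] := ens; rewrite /mutual_info/=.
have P x := tetra_prob hn (rho_psd x); rewrite /= in P.
set m := fun y => Rintegral mu setT (fun x => joint_prob rho pi x y).
(* Each joint probability lies between 0 and the trace of [rho x], which is integrable. *)
have ip y : mu.-integrable setT (fun x => (joint_prob rho pi x y)%:E).
  apply: le_integrable (integrable_ensemble_tr ens) => //.
    by apply/measurable_EFinP; exact: measurable_tr_mul.
  move=> x _; have [p0 <- _] := P x.
  rewrite lee_fin !ger0_norm ?sumr_ge0//; last exact: p0.
  by rewrite (bigD1 y)//= lerDl sumr_ge0.
have mE y : (\int[mu]_x (joint_prob rho pi x y)%:E)%E = (m y)%:E.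
  by rewrite fineK//; exact: integrable_fin_num.
have m0 y : 0 <= m y.
  by apply: Rintegral_ge0 => x _; have [p0 _ _] := P x; exact: p0.
have m1 : \sum_y m y = 1.
  apply: EFin_inj; rewrite -int1 -sumEFin.
  under eq_bigr do rewrite -mE.
  rewrite -integral_sum//; apply: eq_integral => x _.
  by rewrite sumEFin; case: (P x) => _ <-.
(* This upper bound is linear in the joint probabilities, with coefficients constant in [x], so it
   integrates term by term. *)
apply: (@le_trans _ _ (\int[mu]_x
    ((complex.Re (\tr (rho x)))%:E * (ln (4 / 3))%:E
    + \sum_y (joint_prob rho pi x y)%:E * (outcome_cost (m y))%:E))%E).
  apply: le_integral_pointwise => x; have [p0 <- p2] := P x.
  rewrite (eq_bigr
    (fun y => (joint_prob rho pi x y * outcome_cost (m y))%:E))//.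
  rewrite sumEFin -EFinM -EFinD lee_fin.
  exact: info_le.
have iZr (c : R) (f : R -> \bar R) : mu.-integrable setT f ->
    mu.-integrable setT (fun x => (f x * c%:E)%E).
  by move=> fi; under eq_fun do rewrite muleC; exact: integrableZl.
rewrite integralD//; last 2 first.
- by apply: iZr; exact: integrable_ensemble_tr.
- by apply: integrable_sum => // y _; exact: iZr.
rewrite integralZr ?int1 ?mul1e//; last exact: integrable_ensemble_tr.
rewrite integral_sum//; last by move=> y; exact: iZr.
rewrite (eq_bigr (fun y => (m y * outcome_cost (m y))%:E)) => [|y _].
  by rewrite sumEFin -EFinD lee_fin gerDl; exact: outcome_cost_le.
by rewrite integralZr// mE.
Qed.

Lemma tetra_informational_power : informational_power pi = (ln (4 / 3))%:E.
Proof.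
apply/eqP; rewrite eq_le; apply/andP; split.
  apply: ge_ereal_sup => _ [[rho ens ->]|[M [rho ens ->]]].
    exact: tetra_info_le.
  by rewrite lee_fin; exact: tetra_finite_info_le.
apply: ereal_sup_ubound; right; exists 4%N, (anti_ensemble n).
  exact: anti_tetra_is_finite_ensemble.
by rewrite anti_tetra_info.
Qed.

End InformationalPower.

Theorem corollary7 (R : realType) (n : 'I_4 -> 'rV[R]_3)
    (hn : inscribed_regular_tetrahedron n) :
  [/\ is_design_povm 2 (vertex_povm n),
      informational_power (vertex_povm n) = (ln (4 / 3))%:E,
      is_finite_ensemble (anti_ensemble n) /\
      (finite_mutual_info (anti_ensemble n) (vertex_povm n))%:E
        = informational_power (vertex_povm n)
    & forall x : 'I_4, anti_ensemble n x *m vertex_povm n x = 0].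
Proof.
split; [exact: tetra_is_design | exact: tetra_informational_power | |
        exact: anti_tetra_mul].
split; first exact: anti_tetra_is_finite_ensemble.
by rewrite tetra_informational_power// anti_tetra_info.
Qed.
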